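(* Let $K$ be a field, let $\mathcal{P}$ be a finite set of cells of $\mathbb{Z}^2$, let $c$ be the number of cells of $\mathcal{P}$, and let $I_{\mathcal{P}}\subset S=K[x_{\mathbf a} : \mathbf a\in V(\mathcal{P})]$ be the cell ideal of $\mathcal{P}$. Then $$\operatorname{height} I_{\mathcal{P}}\leq c\leq \operatorname{bigheight} I_{\mathcal{P}}.$$ In particular, if $I_{\mathcal{P}}$ is an unmixed ideal, then $\operatorname{height} I_{\mathcal{P}}=c$.
   Context: Partially order $\mathbb{Z}^2$ by $(i,j)\leq (i',j')$ if $i\leq i'$ and $j\leq j'$. For $\mathbf a,\mathbf b\in\mathbb{Z}^2$ the set $[\mathbf a,\mathbf b]=\{\mathbf c\in\mathbb{Z}^2 : \mathbf a\leq\mathbf c\leq\mathbf b\}$ is called an interval; with $\mathbf a=(i,j)$, $\mathbf b=(i',j')$ it is called proper if $i<i'$ and $j<j'$, and in that case its diagonal corners are $\mathbf a,\mathbf b$ and its anti-diagonal corners are $(i,j')$ and $(i',j)$. A cell is an interval $C=[\mathbf a,\mathbf a+(1,1)]$; its vertex set is $V(C)=\{\mathbf a,\mathbf a+(1,0),\mathbf a+(0,1),\mathbf a+(1,1)\}$. A cell $[\mathbf a',\mathbf b']$ is a cell of the proper interval $[\mathbf a,\mathbf b]$ if $\mathbf a\leq\mathbf a'$ and $\mathbf b'\leq\mathbf b$. Let $\mathcal{P}$ be a finite set of cells (no connectedness is assumed). Put $V(\mathcal{P})=\bigcup_{C\in\mathcal{P}}V(C)$. A proper interval $[\mathbf a,\mathbf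 b]$ is an inner interval of $\mathcal{P}$ if every cell of $[\mathbf a,\mathbf b]$ belongs to $\mathcal{P}$. Let $S=K[x_{\mathbf a} : \mathbf a\in V(\mathcal{P})]$ be the polynomial ring over the field $K$ in $|V(\mathcal{P})|$ variables. For each inner interval $[\mathbf a,\mathbf b]$ of $\mathcal{P}$ with anti-diagonal corners $\mathbf c,\mathbf d$, the inner $2$-minor is $f_{\mathbf a,\mathbf b}=x_{\mathbf a}x_{\mathbf b}-x_{\mathbf c}x_{\mathbf d}$. The cell ideal $I_{\mathcal{P}}\subset S$ is the ideal generated by all inner $2$-minors of $\mathcal{P}$. For an ideal $I$, $\operatorname{bigheight} I$ denotes the maximal height of an associated prime ideal of $I$ (an element of $\operatorname{Ass}(I)=\operatorname{Ass}(S/I)$). The ideal $I$ is unmixed if all $P\in\operatorname{Ass}(I)$ have the same height. *)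

(* Defs.v *)
From HB Require Import structures.
From mathcomp Require Import all_boot all_order all_algebra.
From mathcomp Require Import finmap mpoly ring_quotient.
From mathcomp Require Import boolp classical_sets.

Set Implicit Arguments.
Unset Strict Implicit.
Unset Printing Implicit Defensive.

Import Order.TTheory GRing.Theory Num.Theory.

Local Open Scope fset_scope.
Local Open Scope classical_set_scope.
Local Open Scope ring_scope.

Notation gridpoint := (int * int)%type.

Definition le_gridpoint (a b : gridpoint) : bool := (a.1 <= b.1) && (a.2 <= b.2).

(* The cell [C = [a, a + (1,1)]] is represented by its lower left corner [a];
   a set of cells is the set of the lower left corners of its members. *)
Definition cell_vertices (a : gridpoint) : {fset gridpoint} :=
  [fset a; a + (1, 0); a + (0, 1); a + (1, 1)].

Definition vertices (P : {fset gridpoint}) : {fset gridpoint} :=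
  (\bigcup_(a <- P) cell_vertices a)%fset.

Definition proper_interval (a b : gridpoint) : bool :=
  (a.1 < b.1) && (a.2 < b.2).

Definition cell_of_interval (a b e : gridpoint) : bool :=
  le_gridpoint a e && le_gridpoint (e + (1, 1)) b.

Definition inner_interval (P : {fset gridpoint}) (a b : gridpoint) : Prop :=
  proper_interval a b /\
  forall e : gridpoint, cell_of_interval a b e -> e \in P.

(* [S = K[x_a : a in V(P)]], the variables being numbered by [enum_rank]. *)
Notation cell_ring K P := {mpoly K[#|{: vertices P}|]}.

Definition xvar (K : fieldType) (P : {fset gridpoint}) (v : vertices P)
  : cell_ring K P := 'X_(enum_rank v).
Arguments xvar K {P} v.

(* By [inner_interval_corners] below, the four corners of an inner interval
   are vertices of [P], so no minor is lost by quantifying over [vertices P]. *)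
Definition inner_minors (K : fieldType) (P : {fset gridpoint}) : set (cell_ring K P) :=
  [set f | exists a b c d : vertices P,
     [/\ inner_interval P (val a) (val b),
         val c = ((val a).1, (val b).2),
         val d = ((val b).1, (val a).2) &
         f = xvar K a * xvar K b - xvar K c * xvar K d]].
Arguments inner_minors K P : clear implicits.

Definition ideal_span (R : comNzRingType) (G : set R) : set R :=
  [set f | exists (m : nat) (r g : 'I_m -> R),
     (forall i, G (g i)) /\ f = \sum_(i < m) r i * g i].

Definition cell_ideal (K : fieldType) (P : {fset gridpoint}) : set (cell_ring K P) :=
  ideal_span (inner_minors K P).
Arguments cell_ideal K P : clear implicits.

(* [idealr_closed] includes [1 \notin p]. *)
Definition prime_ideal (R : comNzRingType) (p : set R) : Prop :=
  idealr_closed (mem p) /\ prime_idealr_closed (mem p).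

(* [q 0 < q 1 < ... < q k = p], a chain of primes of length [k]. *)
Definition prime_chain (R : comNzRingType) (p : set R) (k : nat) : Prop :=
  exists q : nat -> set R,
    [/\ forall i, (i <= k)%N -> prime_ideal (q i),
        forall i, (i < k)%N -> q i `<` q i.+1 &
        q k = p].

(* Heights are relations, so that no default value is needed when the supremum
   of the lengths of chains is infinite. *)
Definition prime_height (R : comNzRingType) (p : set R) (h : nat) : Prop :=
  prime_chain p h /\ forall k, prime_chain p k -> (k <= h)%N.

Definition ideal_height (R : comNzRingType) (I : set R) (h : nat) : Prop :=
  (exists p, [/\ prime_ideal p, I `<=` p & prime_height p h]) /\
  (forall p k, prime_ideal p -> I `<=` p -> prime_height p k -> (h <= k)%N).

(* [p = I : f], that is, [p] is the annihilator of the class of [f] in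
   [R / I]. *)
Definition associated_prime (R : comNzRingType) (I p : set R) : Prop :=
  prime_ideal p /\ exists f : R, p = [set g | I (g * f)].

Definition bigheight (R : comNzRingType) (I : set R) (b : nat) : Prop :=
  (exists p, associated_prime I p /\ prime_height p b) /\
  (forall p, associated_prime I p ->
     exists2 k, prime_height p k & (k <= b)%N).

Definition unmixed (R : comNzRingType) (I : set R) : Prop :=
  forall p q, associated_prime I p -> associated_prime I q ->
  forall h, prime_height p h <-> prime_height q h.

Lemma cell_vertices_sub (P : {fset gridpoint}) (e v : gridpoint) :
  e \in P -> v \in cell_vertices e -> v \in vertices P.
Proof. by move=> eP ve; apply/bigfcupP; exists e; rewrite ?eP. Qed.

Lemma inner_interval_corners (P : {fset gridpoint}) (a b : gridpoint) :
  inner_interval P a b ->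
  [/\ a \in vertices P, b \in vertices P,
      ((a.1, b.2) : gridpoint) \in vertices P &
      ((b.1, a.2) : gridpoint) \in vertices P].
Proof.
case: a b => [a1 a2] [b1 b2] [/andP[/= lt1 lt2] inP].
have inP' (x y : int) : a1 <= x -> a2 <= y -> x + 1 <= b1 -> y + 1 <= b2 ->
    ((x, y) : gridpoint) \in P.
  by move=> *; apply: inP; rewrite /cell_of_interval /le_gridpoint /=;
     apply/andP; split; apply/andP.
have le1 : a1 + 1 <= b1 by rewrite lezD1.
have le2 : a2 + 1 <= b2 by rewrite lezD1.
have le1' : a1 <= b1 - 1 by rewrite lerBrDr.
have le2' : a2 <= b2 - 1 by rewrite lerBrDr.
have E (x y u v : int) : ((x, y) : gridpoint) + (u, v) = (x + u, y + v) by [].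
split.
- apply: (@cell_vertices_sub P (a1, a2)); [exact: inP' | by rewrite !inE eqxx].
- have e1 : ((b1 - 1, b2 - 1) : gridpoint) \in P by apply: inP'; rewrite ?subrK.
  by apply: cell_vertices_sub e1 _; rewrite !inE !E !subrK eqxx !orbT.
- have e1 : ((a1, b2 - 1) : gridpoint) \in P by apply: inP'; rewrite ?subrK.
  by apply: cell_vertices_sub e1 _; rewrite !inE !E !subrK !addr0 eqxx !orbT.
- have e1 : ((b1 - 1, a2) : gridpoint) \in P by apply: inP'; rewrite ?subrK.
  by apply: cell_vertices_sub e1 _; rewrite !inE !E !subrK !addr0 eqxx !orbT.
Qed.

(* Main.v *)
(* In the Laurent polynomial ring the cell minors of [P] solve the upper right
   corner [x_(e + (1, 1))] of each cell [e] of [P] in terms of the variables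
   that are not such corners.  Hence the saturation [J] of [I_P] with respect
   to the monomials is prime, and the [n - c] remaining variables are
   algebraically independent modulo [J], where [n] is the number of variables.
   Along a chain of primes of [K[x_1, ..., x_n]] the maximal number of
   variables that are independent modulo the prime drops strictly, so
   [height J <= c]; adding the cells one at a time gives a chain of [c + 1]
   such toric primes, so [height J = c].  As [J] is finitely generated,
   [J = I_P : u] for some monomial [u], and [J] is an associated prime of
   [I_P].  In the unmixed case one uses that every prime containing [I_P]
   contains an associated prime of [I_P]. *)
Require Import Defs.
From HB Require Import structures.
From mathcomp Require Import all_boot all_order all_algebra.
From mathcomp Require Import finmap mpoly ring_quotient generic_quotient.
From mathcomp Require Import boolp classical_sets.
From mathcomp Require Import ring zify.

Set Implicit Arguments.
Unset Strict Implicit.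
Unset Printing Implicit Defensive.

Import Order.TTheory GRing.Theory Num.Theory.

Local Open Scope classical_set_scope.
Local Open Scope ring_scope.

(** * Ideals, prime ideals and quotients *)

Definition ideal (R : comNzRingType) (I : set R) : Prop :=
  I 0 /\ forall a u v, I u -> I v -> I (a * u + v).

Section Ideals.
Variable R : comNzRingType.
Implicit Types (I G p : set R) (a u v : R).

Lemma idealM I a u : ideal I -> I u -> I (a * u).
Proof. by move=> [I0 IA] Iu; rewrite -[a * u]addr0; apply: IA. Qed.

Lemma idealD I u v : ideal I -> I u -> I v -> I (u + v).
Proof. by move=> [I0 IA] Iu Iv; rewrite -[u]mul1r; apply: IA. Qed.

Lemma idealB I u v : ideal I -> I u -> I v -> I (u - v).
Proof.
by move=> idI Iu Iv; apply: idealD => //; rewrite -mulN1r; apply: idealM.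
Qed.

Lemma ideal_sum I (T : Type) (r : seq T) (Q : pred T) (F : T -> R) :
  ideal I -> (forall i, Q i -> I (F i)) -> I (\sum_(i <- r | Q i) F i).
Proof.
move=> idI IF; apply: (big_ind I) => // [|u v Iu Iv]; first by case: idI.
exact: idealD.
Qed.

Lemma ideal_spanP I G : ideal I -> G `<=` I -> ideal_span G `<=` I.
Proof.
move=> idI GI _ [m [r [g [Gg ->]]]]; apply: ideal_sum => // i _.
by apply: idealM => //; apply: GI.
Qed.

Lemma mem_ideal_span G : G `<=` ideal_span G.
Proof.
move=> u Gu; exists 1%N, (fun=> 1), (fun=> u); split=> //.
by rewrite big_ord1 mul1r.
Qed.

Lemma ideal_span_ideal G : ideal (ideal_span G).
Proof.
split.
  by exists 0%N, (fun=> 0), (fun=> 0); split; [case | rewrite big_ord0].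
move=> a _ _ [m [r [g [Gg ->]]]] [m' [r' [g' [Gg' ->]]]].
exists (m + m')%N,
  (fun i => match split i with inl j => a * r j | inr j => r' j end),
  (fun i => match split i with inl j => g j | inr j => g' j end).
split; first by move=> i; case: split.
rewrite big_split_ord mulr_sumr; congr (_ + _); apply: eq_bigr => i _.
  by rewrite (unsplitK (inl i)) mulrA.
by rewrite (unsplitK (inr i)).
Qed.

Lemma ideal_span_mono G G' : G `<=` G' -> ideal_span G `<=` ideal_span G'.
Proof.
move=> GG'; apply: ideal_spanP; first exact: ideal_span_ideal.
by move=> u /GG'; apply: mem_ideal_span.
Qed.

Lemma prime_idealP p : prime_ideal p <->
  [/\ ideal p, ~ p 1 & forall u v, p (u * v) -> p u \/ p v].
Proof.
split=> [[[p0 p1 pA] pM]|[[p0 pA] p1 pM]].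
  split; first split.
  - exact: set_mem p0.
  - by move=> a u v pu pv; apply: set_mem (pA a u v _ _); apply: mem_set.
  - by move=> p1'; move/negP: p1; apply; apply: mem_set.
  - move=> u v puv; case/orP: (pM u v (mem_set puv)) => /set_mem ?;
      [by left | by right].
split; first split.
- exact: mem_set.
- by apply/negP => /set_mem.
- by move=> a u v /set_mem pu /set_mem pv; apply: mem_set; apply: pA.
- move=> u v /set_mem /pM[] ?; apply/orP; [left | right]; exact: mem_set.
Qed.

Lemma prime_ideal_ideal p : prime_ideal p -> ideal p.
Proof. by case/prime_idealP. Qed.

Lemma prime_ideal1 p : prime_ideal p -> ~ p 1.
Proof. by case/prime_idealP. Qed.

Lemma prime_idealM p u v : prime_ideal p -> p (u * v) -> p u \/ p v.
Proof. by case/prime_idealP => _ _; apply. Qed.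

Lemma kernel_prime (D : idomainType) (pi : {rmorphism R -> D}) :
  prime_ideal [set u | pi u = 0].
Proof.
apply/prime_idealP; split; first split=> /=.
- exact: rmorph0.
- by move=> a u v u0 v0; rewrite rmorphD rmorphM u0 v0 mulr0 addr0.
- by rewrite /= rmorph1; apply/eqP/oner_neq0.
- by move=> u v /= /eqP; rewrite rmorphM mulf_eq0 => /orP[]/eqP; tauto.
Qed.

End Ideals.

(** The primality proof is an argument so that the ideal structure can be attached to the predicate
    and the quotient ring formed. *)
Definition prime_mem (R : comNzRingType) (p : set R) (pp : prime_ideal p) :
  R -> bool := fun u => u \in p.

HB.instance Definition _ (R : comNzRingType) (p : set R) (pp : prime_ideal p) :=
  isIdealr.Build R (prime_mem pp) pp.1.

Lemma prime_ideal_quotient (R : comNzRingType) (p : set R) : prime_ideal p ->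
  exists (D : comNzRingType) (pi : {rmorphism R -> D}), p = [set u | pi u = 0].
Proof.
move=> pp; pose Q := {ideal_quot (prime_mem pp : idealr R)}.
exists Q, (\pi_Q)%qT.
have piE0 u : ((\pi_Q)%qT u == 0) = (u \in p).
  by rewrite piE Quotient.equivE subr0.
apply/seteqP; split=> u /=.
  by move=> pu; apply/eqP; rewrite piE0 inE.
by move/eqP; rewrite piE0 inE.
Qed.

(** * Algebraic independence of variables modulo a prime, and chains of primes *)

Section Restriction.
Variables (K : fieldType) (n : nat).
Local Notation R := {mpoly K[n]}.
Implicit Types (A B : {set 'I_n}) (f g : R) (p q : set R).

Lemma mpoly_rmorph_eq (S : comNzRingType) (F G : {rmorphism R -> S}) :
  (forall c, F c%:MP = G c%:MP) -> (forall i, F 'X_i = G 'X_i) -> F =1 G.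
Proof.
move=> eqC eqX f; elim/mpolyind: f => [|c m f _ _ IH]; first by rewrite !rmorph0.
rewrite -mul_mpolyC !rmorphD !rmorphM eqC IH mpolyXE_id !rmorph_prod.
by congr (_ * _ + _); apply: eq_bigr => i _; rewrite !rmorphXn eqX.
Qed.

(* The subring generated by the variables in [A] is handled as the image of
   this retraction. *)
Definition restrict A : R -> R :=
  mmap (@mpolyC n K) (fun i => if i \in A then 'X_i else 0).

HB.instance Definition _ A := GRing.RMorphism.on (restrict A).

Lemma restrictC A c : restrict A c%:MP = c%:MP.
Proof. exact: mmapC. Qed.

Lemma restrictX A i : restrict A 'X_i = if i \in A then 'X_i else 0.
Proof. by rewrite /restrict mmapX mmap1U. Qed.

Lemma restrict_restrict A B f : A \subset B -> restrict B (restrict A f) = restrict A f.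
Proof.
move=> AB; move: f; apply: (@mpoly_rmorph_eq _ (restrict B \o restrict A) (restrict A)) => /=.
  by move=> c; rewrite !restrictC.
move=> i; rewrite !restrictX; case: ifP => iA; last by rewrite rmorph0.
by rewrite restrictX (fintype.subsetP AB _ iA).
Qed.

Definition independent_mod p A := forall f, p (restrict A f) -> restrict A f = 0.

Lemma independent_mod_sub p q A :
  p `<=` q -> independent_mod q A -> independent_mod p A.
Proof. by move=> pq indA f /pq; apply: indA. Qed.

Lemma independent_mod0 p : prime_ideal p -> independent_mod p finset.set0.
Proof.
move=> pp f; have -> : restrict finset.set0 f = (f.@[fun=> 0])%:MP.
  move: f.
  apply: (@mpoly_rmorph_eq _ (restrict finset.set0) (@mpolyC n K \o meval (fun=> 0))).
    by move=> c /=; rewrite restrictC mevalC.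
  by move=> i /=; rewrite restrictX inE mevalXU.
move: (f.@[_]) => c pc; have [->|c0] := eqVneq c 0; first exact: mpolyC0.
case: (prime_ideal1 pp); rewrite -mpolyC1 -(mulVf c0) mpolyCM.
exact: idealM (prime_ideal_ideal pp) pc.
Qed.

(** For a prime [p] this is the transcendence degree over [K] of the fraction field of [R / p],
    since the classes of the variables generate that field. *)
Definition indep_dim p : nat :=
  \max_(A : {set 'I_n} | `[< independent_mod p A >]) #|A|.

Lemma indep_dim_ge p A : independent_mod p A -> (#|A| <= indep_dim p)%N.
Proof. by move=> /asboolP iA; apply: leq_bigmax_cond. Qed.

Lemma indep_dimP p : prime_ideal p ->
  exists2 A, independent_mod p A & #|A| = indep_dim p.
Proof.
move=> pp; have := @eq_bigmax_cond _ (fun A => `[< independent_mod p A >]) (fun A => #|A|).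
case=> [|A iA eqA]; last by exists A; [exact/asboolP | rewrite -eqA].
by apply/card_gt0P; exists finset.set0; apply/asboolP/independent_mod0.
Qed.

Section Algebraic.
Variables (D : comNzRingType) (pi : {rmorphism R -> D}).
Hypothesis pp : prime_ideal [set f | pi f = 0].
Variable A : {set 'I_n}.

Let RtoD : {rmorphism R -> D} := pi \o restrict A.

(** Being algebraic over the fractions of the subring of [A], with the denominator cleared: closure
    under sums and products then follows from that of integral elements. *)
Definition algebraic_mod f :=
  exists2 a, pi (restrict A a) <> 0 & integralOver RtoD (pi (restrict A a * f)).

Let pi_neq0M f g : pi f <> 0 -> pi g <> 0 -> pi (f * g) <> 0.
Proof. by move=> f0 g0 fg0; case: (prime_idealM pp fg0). Qed.

Let int_restrict a : integralOver RtoD (pi (restrict A a)).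
Proof. exact: (integral_id RtoD). Qed.

Lemma algebraic_modD f g : algebraic_mod f -> algebraic_mod g -> algebraic_mod (f + g).
Proof.
move=> [a a0 af] [b b0 bg]; exists (a * b).
  by rewrite (rmorphM (restrict A)); apply: pi_neq0M.
rewrite (rmorphM (restrict A)) mulrDr -mulrA [_ * (_ * f)]mulrCA -mulrA rmorphD.
by apply: integral_add; rewrite (rmorphM pi); apply: integral_mul => //;
  apply: int_restrict.
Qed.

Lemma algebraic_modM f g : algebraic_mod f -> algebraic_mod g -> algebraic_mod (f * g).
Proof.
move=> [a a0 af] [b b0 bg]; exists (a * b).
  by rewrite (rmorphM (restrict A)); apply: pi_neq0M.
by rewrite (rmorphM (restrict A)) mulrACA rmorphM; apply: integral_mul.
Qed.

Lemma algebraic_mod_restrict a : algebraic_mod (restrict A a).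
Proof.
exists 1; first by rewrite !rmorph1; apply/eqP/oner_neq0.
by rewrite rmorph1 mul1r; apply: int_restrict.
Qed.

Lemma algebraic_mod_gen :
  (forall i, i \notin A -> algebraic_mod 'X_i) -> forall f, algebraic_mod f.
Proof.
have algC c : algebraic_mod c%:MP.
  by rewrite -(restrictC A); apply: algebraic_mod_restrict.
move=> algX; have {}algX i : algebraic_mod 'X_i.
  have [iA|/algX//] := boolP (i \in A).
  by have := algebraic_mod_restrict 'X_i; rewrite restrictX iA.
elim/mpolyind => [|c m f _ _ IH]; first by rewrite -mpolyC0.
apply: algebraic_modD => //; rewrite -mul_mpolyC; apply: algebraic_modM => //.
rewrite mpolyXE_id; apply: (big_ind algebraic_mod) => // [||i _].
- by rewrite -mpolyC1.
- exact: algebraic_modM.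
- by elim: (m i) => [|k IHk]; rewrite ?expr0 -?mpolyC1 // exprS; apply: algebraic_modM.
Qed.

(* Multiplying [G(f) = 0] by [lead_coef G ^+ (deg G - 1)] gives a monic
   equation for [lead_coef G * f]. *)
Lemma integral_lead_coefM (G : {poly R}) f :
  map_poly (restrict A) G = G -> (1 < size G)%N -> (map_poly pi G).[pi f] = 0 ->
  integralOver RtoD (pi (lead_coef G * f)).
Proof.
move=> resG sG rootf; set a := lead_coef G.
have intG j : integralOver RtoD (pi G`_j).
  by rewrite -resG coef_map; apply: int_restrict.
have [m sGm] : exists m, size G = m.+2 by exists (size G).-2; case: size sG => [|[]].
pose H : {poly D} := 'X^(m.+1) + \poly_(j < m.+1) (pi G`_j * pi a ^+ (m - j)).
apply: (@integral_root_monic _ _ RtoD _ H).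
- rewrite monicE lead_coefDl ?lead_coefXn //.
  by rewrite size_polyXn ltnS size_poly.
- apply/rootP; have: pi a ^+ m * (map_poly pi G).[pi f] = 0 by rewrite rootf mulr0.
  rewrite (@horner_coef_wide _ m.+2); last by rewrite -sGm size_poly.
  move<-; rewrite hornerD hornerXn horner_poly addrC [in RHS]big_ord_recr /= mulrDr.
  congr (_ + _).
    rewrite mulr_sumr; apply: eq_bigr => j _; rewrite coef_map rmorphM exprMn.
    have jm : (j <= m)%N by rewrite -ltnS.
    have -> : pi a ^+ m = pi a ^+ (m - j) * pi a ^+ j by rewrite -exprD subnK.
    by rewrite [RHS]mulrACA [pi a ^+ _ * pi _]mulrC.
  rewrite coef_map /= (_ : G`_m.+1 = a); last by rewrite /a lead_coefE sGm.
  by rewrite rmorphM exprMn exprSr mulrA.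
- apply/integral_poly => j; rewrite coefD coefXn coef_poly; apply: integral_add.
    exact: (integral_nat RtoD).
  case: ifP => _; last exact: (integral0 RtoD).
  apply: integral_mul => //; rewrite -rmorphXn.
  rewrite /a lead_coefE -resG coef_map -rmorphXn; exact: int_restrict.
Qed.

(** A relation among the variables in [i |: A] is read as a polynomial in ['X_i] over the subring of
    [A]; independence of [A] keeps its leading coefficient nonzero under [pi]. *)
Lemma algebraic_mod_dependent i :
  i \notin A -> independent_mod [set f | pi f = 0] A ->
  ~ independent_mod [set f | pi f = 0] (i |: A) -> algebraic_mod 'X_i.
Proof.
move=> iA indA; case/existsNP => f /not_implyP[/=]; set g := restrict _ f => pg0 g0.
pose psi : {rmorphism R -> {poly R}} :=
  mmap (polyC \o @mpolyC n K) (fun j => if j == i then 'X else ('X_j)%:P).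
have psiC c : psi c%:MP = (c%:MP)%:P by rewrite /psi /= mmapC.
have psiX j : psi 'X_j = if j == i then 'X else ('X_j)%:P.
  by rewrite /psi /= mmapX mmap1U.
have psig : map_poly (restrict A) (psi g) = psi g.
  rewrite /g; move: f {g pg0 g0}.
  apply: (@mpoly_rmorph_eq _ (map_poly (restrict A) \o psi \o restrict (i |: A))
     (psi \o restrict (i |: A))) => [c|j] /=.
    by rewrite restrictC psiC map_polyC /= restrictC.
  rewrite restrictX !inE; case: eqP => [->|/eqP/negPf ji] /=.
    by rewrite psiX eqxx map_polyX.
  case: ifP => jA; last by rewrite !rmorph0.
  by rewrite psiX ji map_polyC /= restrictX jA.
have psi_ev : (psi g).['X_i] = g.
  apply: (@mpoly_rmorph_eq _ (horner_eval 'X_i \o psi) idfun) => [c|j] /=.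
    by rewrite psiC /horner_eval hornerC.
  by rewrite psiX /horner_eval; case: eqP => [->|_]; rewrite ?hornerX ?hornerC.
have lead_res : restrict A (lead_coef (psi g)) = lead_coef (psi g).
  by have := congr1 (coefp (size (psi g)).-1) psig; rewrite /= coef_map.
have lead0 : pi (lead_coef (psi g)) <> 0.
  rewrite -lead_res => /indA; rewrite lead_res => /eqP.
  by rewrite lead_coef_eq0 => /eqP psi0; apply: g0; rewrite -psi_ev psi0 horner0.
exists (lead_coef (psi g)); rewrite lead_res //.
apply: integral_lead_coefM => //; last by rewrite horner_map psi_ev.
(* Were [psi g] constant, its leading coefficient would be [g] itself, which [pi] kills. *)
rewrite ltnNge; apply/negP => /size1_polyC; set c := _`_0 => psi0.
by apply: lead0; rewrite psi0 lead_coefC; rewrite -(hornerC c 'X_i) -psi0 psi_ev.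
Qed.

End Algebraic.

(** Take [A] of maximal size independent modulo [q]. If no larger set were independent modulo [p],
    every element would be algebraic over the variables in [A] modulo [p]; an element of [q] outside
    [p] contradicts this. *)
Lemma indep_dim_lt p q : prime_ideal p -> prime_ideal q -> p `<` q ->
  (indep_dim q < indep_dim p)%N.
Proof.
move=> pp pq [spq /existsNP[f /not_implyP[qf pf]]].
have [A indA cardA] := indep_dimP pq.
rewrite ltnNge -cardA; apply/negP => ledim.
have indpA := independent_mod_sub spq indA.
have [D [pi defp]] := prime_ideal_quotient pp.
rewrite defp in pp indpA; have [|a a0 [h hmon hroot]] := @algebraic_mod_gen D pi pp A _ f.
  move=> i iA; apply: algebraic_mod_dependent => // ind.
  have := indep_dim_ge ind; rewrite -defp cardsU1 iA.
  by move=> /leq_trans/(_ ledim); rewrite ltnn.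
set g := _ * f in hroot.
have qg : q g by apply: idealM => //; apply: prime_ideal_ideal.
have pg : pi g <> 0.
  move=> /(prime_idealM pp)[//|/=]; move: pf; rewrite defp; exact.
(* Cancelling powers of [g], a relation of [g] over the subring generated by
   [A] has a nonzero constant term, which then lies in [q]. *)
have: map_poly (pi \o restrict A) h = 0.
  move: hroot {hmon}; elim: {h}(size h) {-2}h (leqnn (size h)) => [|m IH] h.
    by rewrite leqn0 size_poly_eq0 => /eqP -> _; rewrite map_poly0.
  elim/poly_ind: h => [|h c _]; first by rewrite map_poly0.
  move=> sh; rewrite rmorphD rmorphM /= map_polyX map_polyC => /rootP.
  rewrite hornerD hornerM hornerX hornerC /= => hroot.
  have c0 : restrict A c = 0.
    apply: indA; have -> : restrict A c = (map_poly (restrict A) h).[g] * g + restrict A c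
       - (map_poly (restrict A) h).[g] * g by rewrite addrAC subrr add0r.
    have idq := prime_ideal_ideal pq.
    apply: idealB => //; last exact: idealM.
    apply: spq; rewrite defp /= rmorphD rmorphM -horner_map -map_poly_comp.
    exact: hroot.
  move: hroot; rewrite c0 rmorph0 addr0 polyC0 addr0 => hroot.
  rewrite IH ?mul0r //.
    have [->|h0] := eqVneq h 0; first by rewrite size_poly0.
    by move: sh; rewrite size_MXaddC (negPf h0).
  apply/rootP; move: hroot.
  rewrite (map_poly_comp pi (restrict A)) horner_map -rmorphM.
  by move/(prime_idealM pp) => [].
move/(congr1 (coefp (size h).-1)) => /=; rewrite coef0 coef_map /=.
rewrite -lead_coefE (monicP hmon) !rmorph1 => /eqP; exact/negP/oner_neq0.
Qed.

(** Every strict inclusion lowers [indep_dim] by at least one, and at the bottom of the chain it is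
    at most [n]. *)
Lemma prime_chain_leq p k : prime_chain p k -> (k + indep_dim p <= n)%N.
Proof.
move=> [q [prq ltq <-]].
elim: k prq ltq => [|k IH] prq ltq.
  apply/bigmax_leqP => A _; rewrite -[n in (_ <= n)%N]card_ord; exact: max_card.
apply: leq_trans (IH _ _).
- by rewrite addSnnS leq_add2l; apply: indep_dim_lt; [apply: prq|apply: prq|apply: ltq].
- by move=> i /leqW; apply: prq.
- by move=> i /leqW; apply: ltq.
Qed.

End Restriction.

(** * Dickson's lemma, the Hilbert basis theorem and associated primes *)

Lemma nondecreasing_subsequence (f : nat -> nat) : exists s : nat -> nat,
  (forall i j, (i < j)%N -> (s i < s j)%N) /\
  (forall i j, (i <= j)%N -> (f (s i) <= f (s j))%N).
Proof.
(* [c N] is an index from [N] on at which [f] attains its minimum over that tail. *)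
have /choice[c cP] N : exists m, (N <= m)%N /\ forall k, (N <= k)%N -> (f m <= f k)%N.
  have [v] : exists v, `[< exists2 m, (N <= m)%N & f m = v >].
    by exists (f N); apply/asboolP; exists N.
  elim/ltn_ind: v => v IH /asboolP[m Nm fm].
  have [[k [Nk fk]]|nk] := EM (exists k, (N <= k)%N /\ (f k < f m)%N).
    by apply: (IH (f k)); [rewrite -fm | apply/asboolP; exists k].
  exists m; split=> // k Nk; rewrite leqNgt; apply/negP => fk; apply: nk.
  by exists k.
pose s := fix s k := if k is k'.+1 then c (s k').+1 else c 0%N.
have s_lt k : (s k < s k.+1)%N by have [] := cP (s k).+1.
have s_homo i j : (i < j)%N -> (s i < s j)%N.
  by move=> ij; apply: (homo_ltn ltn_trans s_lt).
exists s; split=> // i j; rewrite leq_eqVlt => /predU1P[->//|ij].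
case: i ij => [|i] ij /=; first by have [_] := cP 0%N; apply.
by have [_] := cP (s i).+1; apply; apply: s_homo; apply: ltn_trans ij.
Qed.

(** Subsequences are extracted for one variable after the other until all exponents are
    nondecreasing. *)
Lemma dickson n (m : nat -> 'X_{1..n}) : exists i j, (i < j)%N /\ (m i <= m j)%MM.
Proof.
have [s [s_lt s_le]] : exists s : nat -> nat, (forall i j, (i < j)%N -> (s i < s j)%N) /\
    forall x, x \in enum 'I_n -> forall i j, (i <= j)%N -> (m (s i) x <= m (s j) x)%N.
  elim: (enum 'I_n) => [|x r [s [s_lt s_le]]]; first by exists id.
  have [t [t_lt t_le]] := nondecreasing_subsequence (fun i => m (s i) x).
  exists (s \o t); split=> [i j ij|y /predU1P[->|yr] i j ij] /=.
  - exact/s_lt/t_lt.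
  - exact: t_le.
  - apply: s_le => //; move: ij; rewrite leq_eqVlt => /predU1P[->//|/t_lt/ltnW//].
exists (s 0%N), (s 1%N); split; first exact: s_lt.
by apply/mnm_lepP => x; apply: s_le; rewrite ?mem_enum.
Qed.

Section Noetherian.
Variables (K : fieldType) (n : nat).
Local Notation R := {mpoly K[n]}.
Implicit Types (I p : set R) (s : seq R).

(** Otherwise one keeps adding an element of [I] outside the span so far, with smallest leading
    monomial. By Dickson's lemma the leading monomial of some element divides that of a later one,
    and reducing the later by the earlier contradicts minimality. *)
Theorem hilbert_basis I : ideal I ->
  exists s, (forall u, u \in s -> I u) /\ I `<=` ideal_span [set u | u \in s].
Proof.
move=> idI; apply: contrapT => nfg.
have step s : exists u, (forall v, v \in s -> I v) ->
    [/\ I u, ~ ideal_span [set v | v \in s] u &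
      forall v, I v -> ~ ideal_span [set w | w \in s] v -> (mlead u <= mlead v)%O].
  have [sI|nsI] := EM (forall v, v \in s -> I v); last by exists 0 => /nsI.
  have [u [Iu su]] : exists u, I u /\ ~ ideal_span [set v | v \in s] u.
    apply: contrapT => nu; apply: nfg; exists s; split=> // u Iu.
    by apply: contrapT => su; apply: nu; exists u.
  elim/mleadrect: u Iu su => u IH Iu su.
  have [[v [Iv sv vu]]|nv] := EM (exists v, [/\ I v,
      ~ ideal_span [set w | w \in s] v & (mlead v < mlead u)%O]).
    exact: IH vu Iv sv.
  exists u => _; split=> // v Iv sv; rewrite leNgt; apply/negP => vu.
  by apply: nv; exists v.
have [next nextP] := choice step.
pose l := fix l k := if k is k'.+1 then rcons (l k') (next (l k')) else [::].
have lI k v : v \in l k -> I v.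
  elim: k v => [|k IH] v //=; rewrite mem_rcons => /predU1P[->|/IH//].
  by have [] := nextP (l k) IH.
have ll i j : (i < j)%N -> next (l i) \in l j.
  elim: j => // j IH; rewrite ltnS leq_eqVlt /= mem_rcons inE.
  by move=> /predU1P[->|/IH ->]; rewrite ?eqxx ?orbT.
have [i [j [ij mij]]] := dickson (fun k => mlead (next (l k))).
have [_ nsu _] := nextP (l i) (@lI i); have [Iv nsv minv] := nextP (l j) (@lI j).
have {ll ij}su : ideal_span [set w | w \in l j] (next (l i)).
  by apply: mem_ideal_span; apply: ll.
move: (next (l i)) (next (l j)) su nsu Iv nsv minv mij => u v su nsu Iv nsv minv mij.
have idS := ideal_span_ideal.
have nz w s : ~ ideal_span [set w | w \in s] w -> w != 0.
  by move=> nw; apply/eqP => w0; apply: nw; rewrite w0; case: (idS _ [set w | w \in s]).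
have u0 := nz _ _ nsu; have v0 := nz _ _ nsv.
(* [g] is the multiple of [u] with the leading term of [v], so the leading terms cancel in
   [v - g]. *)
pose c := mleadc v / mleadc u; pose g := c *: 'X_[(mlead v - mlead u)] * u.
have c0 : c != 0 by rewrite mulf_neq0 ?invr_eq0 ?mleadc_eq0.
have X0 : c *: 'X_[(mlead v - mlead u)] != 0 :> R.
  by rewrite -mleadc_eq0 mleadZ // mleadXm mcoeffZ mcoeffX eqxx mulr1.
have leadg : mlead g = mlead v.
  by rewrite mleadM // mleadZ // mleadXm submK.
have leadcg : mleadc g = mleadc v.
  rewrite mleadM // mleadcM mleadZ // mleadXm mcoeffZ mcoeffX eqxx mulr1.
  by rewrite divfK // mleadc_eq0.
have sg : ideal_span [set w | w \in l j] g by apply: idealM.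
have nsw : ~ ideal_span [set w | w \in l j] (v - g).
  by move=> sw; apply: nsv; rewrite -[v](subrK g); apply: idealD.
have Ig : I g by apply: ideal_spanP sg => // w /lI.
have := minv _ (idealB idI Iv Ig) nsw; apply/negP; rewrite -ltNge.
have := mleadB_le v g; rewrite leadg joinxx le_eqVlt => /predU1P[eqw|//].
have := nz _ _ nsw; rewrite -mleadc_eq0 eqw mcoeffB -{2}leadg leadcg.
by rewrite subrr eqxx.
Qed.

Lemma ascending_chain_stationary (I : nat -> set R) :
  (forall k, ideal (I k)) -> (forall k, I k `<=` I k.+1) ->
  exists N, forall k, I k `<=` I N.
Proof.
move=> idI subI.
have mono i j : (i <= j)%N -> I i `<=` I j.
  elim: j => [|j IH]; first by rewrite leqn0 => /eqP->.
  rewrite leq_eqVlt => /predU1P[-> //|ij].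
  exact: subset_trans (IH ij) (subI j).
pose U : set R := [set u | exists k, I k u].
have idU : ideal U.
  split; first by exists 0%N; case: (idI 0%N).
  move=> a u v [i Iu] [j Iv]; exists (maxn i j).
  have [_] := idI (maxn i j); apply.
    exact: (mono i _ (leq_maxl _ _)).
  exact: (mono j _ (leq_maxr _ _)).
have [s [sU Us]] := hilbert_basis idU.
have [N sN] : exists N, forall u, u \in s -> I N u.
  elim: s sU {Us} => [|u s IH] sU; first by exists 0%N.
  have [|N sN] := IH; first by move=> v vs; apply: sU; rewrite inE vs orbT.
  have [k Iu] := sU u (mem_head _ _); exists (maxn k N) => v /predU1P[->|/sN].
    exact: (mono k _ (leq_maxl _ _)).
  exact: (mono N _ (leq_maxr _ _)).
exists N => k u Iku; apply: (ideal_spanP (idI N) sN); apply: Us; by exists k.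
Qed.

Lemma maximal_ideal_in_family (T : Type) (J : T -> set R) (Q : T -> Prop) :
  (exists t, Q t) -> (forall t, Q t -> ideal (J t)) ->
  exists t, Q t /\ forall t', Q t' -> J t `<=` J t' -> J t' `<=` J t.
Proof.
move=> [t0 Qt0] idJ; apply: contrapT => nmax.
have /choice[next nextP] t : exists t', Q t ->
    [/\ Q t', J t `<=` J t' & ~ J t' `<=` J t].
  have [Qt|nQt] := EM (Q t); last by exists t.
  apply: contrapT => nt; apply: nmax; exists t; split=> // t' Qt' tt'.
  by apply: contrapT => t't; apply: nt; exists t' => _.
have Qn k : Q (iter k next t0) by elim: k => //= k /nextP[].
have [k|k|N NP] := @ascending_chain_stationary (fun k => J (iter k next t0)).
- exact: idJ.
- by have [] := nextP _ (Qn k).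
- by have [_ _] := nextP _ (Qn N); apply; apply: (NP N.+1).
Qed.

Lemma associated_prime_below I p : ideal I -> prime_ideal p -> I `<=` p ->
  exists q, [/\ associated_prime I q, I `<=` q & q `<=` p].
Proof.
move=> idI pp Ip; have idp := prime_ideal_ideal pp.
(* [J g] is the annihilator of the class of [g] in the localization of [R / I]
   at [p]; a maximal proper one is prime. *)
pose J g : set R := [set r | exists2 s, ~ p s & I (s * (r * g))].
have idJ g : ideal (J g).
  split; first by exists 1; [exact: prime_ideal1 | rewrite mul0r mulr0; case: idI].
  move=> a u v [s ps su] [t pt tv]; exists (s * t); first by move/(prime_idealM pp) => [].
  have -> : s * t * ((a * u + v) * g) = (a * t) * (s * (u * g)) + s * (t * (v * g)).
    by ring.
  by apply: idealD => //; apply: idealM.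
have [||g [J1 gmax]] := @maximal_ideal_in_family _ J (fun g => ~ J g 1).
- by exists 1; case=> s ps; rewrite !mulr1 => /Ip.
- by move=> g _; apply: idJ.
have Jp : J g `<=` p.
  move=> u [s ps su]; apply: contrapT => pu; apply: J1; exists (s * u).
    by move/(prime_idealM pp) => [].
  by rewrite mul1r -mulrA.
have IJ : I `<=` J g.
  move=> u Iu; exists 1; first exact: prime_ideal1.
  by rewrite mul1r mulrC; apply: idealM.
have pJ : prime_ideal (J g).
  apply/prime_idealP; split=> // u v Juv.
  have [Jv|nJv] := EM (J g v); [by right | left].
  (* As [v] is outside [J g], the ideal [J (v * g)] is proper; it contains [J g], so by maximality
     it equals [J g], and it contains [u]. *)
  apply: (gmax (v * g)).
  - by case=> s ps; rewrite mul1r => sv; apply: nJv; exists s.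
  - move=> w [s ps sw]; exists s => //.
    by have -> : s * (w * (v * g)) = v * (s * (w * g)) by [ring]; apply: idealM.
  - by case: Juv => s ps; rewrite -mulrA; exists s.
(* Finitely many generators have a common denominator [s] outside [p], which turns [J g] into
   [I : (s * g)]. *)
have [r [rJ Jr]] := hilbert_basis (idJ g).
have [s ps sP] : exists2 s, ~ p s & forall u, u \in r -> I (s * (u * g)).
  elim: r rJ {Jr} => [|u r IH] rJ; first by exists 1 => //; exact: prime_ideal1.
  have [|s ps sP] := IH; first by move=> v vr; apply: rJ; rewrite inE vr orbT.
  have [t pt tu] := rJ u (mem_head _ _); exists (s * t).
    by move/(prime_idealM pp) => [].
  move=> v /predU1P[->|/sP vI]; first by rewrite -mulrA; apply: idealM.
  by rewrite [s * t]mulrC -mulrA; apply: idealM.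
exists (J g); split=> //; split=> //; exists (s * g).
apply/seteqP; split=> u /=; last by move=> us; exists s => //; rewrite mulrCA.
have idC : ideal [set u | I (u * (s * g))].
  split=> [|a v w Iv Iw] /=; first by rewrite mul0r; case: idI.
  by rewrite mulrDl -mulrA; have [_] := idI; apply.
by move=> /Jr /(ideal_spanP idC); apply=> v /sP /=; rewrite mulrCA.
Qed.

End Noetherian.

(** * Nowhere vanishing solutions of the cell relations on the grid *)

Lemma finite_min_ind (T : finType) (h : T -> int) (Q : T -> Prop) :
  (forall v, (forall w, h w < h v -> Q w) -> Q v) -> forall v, Q v.
Proof.
move=> IH v; apply: contrapT => nQv.
have bad : `[< ~ Q v >] by apply/asboolP.
case: (@arg_minP _ int T v (fun w => `[< ~ Q w >]) h bad) => w /asboolP nQw minw.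
apply: nQw; apply: IH => u uw; apply: contrapT => /asboolP /minw.
by rewrite leNgt uw.
Qed.

Section GridFunctions.
Variable F : fieldType.
Implicit Types (th : gridpoint -> F) (e v : gridpoint) (s : seq gridpoint).

Definition cell_relation th e :=
  th e * th (e + (1, 1)) = th (e + (0, 1)) * th (e + (1, 0)).

(* The values at the upper right corners of the cells are determined one after
   the other, in order of increasing coordinate sum. *)
Lemma cell_relations_solvable (x : gridpoint -> F) s : (forall v, x v != 0) ->
  exists th, [/\ forall v, th v != 0, forall e, e \in s -> cell_relation th e &
    forall v, v - (1, 1) \notin s -> th v = x v].
Proof.
(* The list is sorted by decreasing coordinate sum: the induction solves the tail first, so the head
   is the last cell treated. *)
move=> x0; pose ge_sum (e e' : gridpoint) := (e'.1 + e'.2 <= e.1 + e.2).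
have sorted_s : sorted ge_sum (sort ge_sum s).
  by apply: sort_sorted => e e'; apply: le_total.
have {sorted_s} : exists th, [/\ forall v, th v != 0,
    forall e, e \in sort ge_sum s -> cell_relation th e &
    forall v, v - (1, 1) \notin sort ge_sum s -> th v = x v].
  elim: (sort ge_sum s) sorted_s => [|e r IH] sorted_r; first by exists x.
  have ge_e : all (ge_sum e) r.
    by apply: order_path_min sorted_r => e1 e2 e3 h1 h2; apply: le_trans h1.
  have [th [th0 thr thx]] := IH (path_sorted sorted_r).
  have [er|er] := boolP (e \in r).
    exists th; split=> // [e' /predU1P[->|]|v]; [exact: thr | exact: thr |].
    by rewrite inE negb_or => /andP[_]; apply: thx.
  pose th' v := if v == e + (1, 1) then th (e + (0, 1)) * th (e + (1, 0)) / th e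
                else th v.
  (* Only the value at [e + (1, 1)] changes. Its coordinate sum exceeds that of the other three
     corners of [e] and of every cell treated before. *)
  have th'E d v : ge_sum e v -> (d.1 + d.2 < 2) -> th' (v + d) = th (v + d).
    move=> ve d2; rewrite /th'; case: eqP => // ed.
    move: ve d2; rewrite /ge_sum; have := congr1 fst ed; have := congr1 snd ed => /=.
    lia.
  have ee : ge_sum e e by exact: lexx.
  exists th'; split=> [v|e' e'r|v].
  - by rewrite /th'; case: ifP => // _; apply: mulf_neq0; rewrite ?invr_eq0 ?mulf_neq0.
  - rewrite /cell_relation.
    have e'e : ge_sum e e' by move: e'r => /predU1P[->//|/(allP ge_e)].
    have := th'E 0 e' e'e isT; rewrite addr0 => ->.
    rewrite (th'E (0, 1)) // (th'E (1, 0)) //; move: e'r => /predU1P[->|e'r].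
      by rewrite /th' eqxx mulrC divfK.
    rewrite /th' (inj_eq (addIr _)); case: eqP => [e'E|_]; last exact: thr.
    by case/negP: er; rewrite -e'E.
  - rewrite inE negb_or => /andP[ve vr]; rewrite /th'; case: eqP => [vE|_].
      by rewrite vE addrK eqxx in ve.
    exact: thx.
case=> th [th0 thr thx]; exists th; split=> // [e es|v vs].
  by apply: thr; rewrite mem_sort.
by apply: thx; rewrite mem_sort.
Qed.

(** Two rectangles that share the edge with values [c] and [d] merge into one; the nonzero [c] is
    cancelled. *)
Lemma glue_relations (a b c d e f : F) :
  c != 0 -> a * d = b * c -> c * f = e * d -> a * f = b * e.
Proof.
move=> c0 ad cf; apply: (mulIf c0); apply/eqP; rewrite -subr_eq0.
have -> : a * f * c - b * e * c = a * (c * f - e * d) + e * (a * d - b * c) by ring.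
by rewrite ad cf !subrr !mulr0 addr0.
Qed.

(** Cells are glued into rows of height one, and the rows are then stacked; nonvanishing of [th]
    permits each cancellation. *)
Lemma inner_interval_relation (P : {fset gridpoint}) th (a b : gridpoint) :
  (forall v, th v != 0) -> (forall e, e \in P -> cell_relation th e) ->
  inner_interval P a b -> th a * th b = th (a.1, b.2) * th (b.1, a.2).
Proof.
move=> th0 thP [/andP[ab1 ab2] inP]; case: a b ab1 ab2 inP => [x y] [x' y'] /= ab1 ab2 inP.
have [k x'E] : exists k : nat, x' = x + k%:Z by exists `|x' - x|%N; lia.
have [l y'E] : exists l : nat, y' = y + l%:Z by exists `|y' - y|%N; lia.
have cellP (i j : nat) : (i < k)%N -> (j < l)%N ->
    cell_relation th (x + i%:Z, y + j%:Z).
  move=> ik jl; apply/thP/inP; rewrite /cell_of_interval /le_gridpoint /=; lia.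
have {ab1 ab2 inP}: (0 < l)%N by lia.
rewrite {}x'E {}y'E.
have row (i j : nat) : (i <= k)%N -> (j < l)%N ->
    th (x, y + j%:Z) * th (x + i%:Z, y + j.+1%:Z)
    = th (x, y + j.+1%:Z) * th (x + i%:Z, y + j%:Z).
  move=> + jl; elim: i => [|i IH] ik; first by rewrite addr0 mulrC.
  apply: (glue_relations (th0 (x + i%:Z, y + j%:Z)) (IH (ltnW ik))).
  have := cellP i j ik jl; rewrite /cell_relation.
  rewrite (_ : (_, _) + (1, 1) = (x + i.+1%:Z, y + j.+1%:Z)); last first.
    by congr (_, _) => /=; lia.
  rewrite (_ : (_, _) + (0, 1) = (x + i%:Z, y + j.+1%:Z)); last first.
    by congr (_, _) => /=; lia.
  rewrite (_ : (_, _) + (1, 0) = (x + i.+1%:Z, y + j%:Z)); last first.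
    by congr (_, _) => /=; lia.
  by move=> ->; rewrite mulrC.
have rectangle (j : nat) : (j < l)%N -> th (x, y) * th (x + k%:Z, y + j.+1%:Z)
    = th (x, y + j.+1%:Z) * th (x + k%:Z, y).
  elim: j => [|j IH] jl; first by have := row k 0%N (leqnn k) jl; rewrite addr0.
  rewrite [RHS]mulrC.
  apply: (glue_relations (th0 (x, y + j.+1%:Z))); last by rewrite row // mulrC.
  by rewrite IH ?(ltnW jl) // mulrC.
by case: l {cellP row} rectangle => // l rectangle _; apply: rectangle.
Qed.

End GridFunctions.

(** * Toric ideals of sets of cells and their height *)

Lemma mpolyX_neq0 (R : nzRingType) n (m : 'X_{1..n}) : 'X_[m] != 0 :> {mpoly R[n]}.
Proof. by rewrite -mleadc_eq0 mleadXm mcoeffX eqxx oner_neq0. Qed.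

Lemma fraction_embedding (D : idomainType) :
  exists (F : fieldType) (iota : {rmorphism D -> F}), injective iota.
Proof.
exists {fraction D}, (@tofrac D : {rmorphism D -> {fraction D}}) => x y /eqP.
by rewrite tofrac_eq => /eqP.
Qed.

Section Toric.
Variables (K : fieldType) (P : {fset gridpoint}).
Local Notation V := (vertices P).
Local Notation R := (cell_ring K P).
Local Notation n := #|{: V}|.
Implicit Types (e v : gridpoint) (s : seq gridpoint).

(* The value off [V] is irrelevant, but it has to be nonzero. *)
Definition gridvar v : R := if insub v is Some w then xvar K (w : V) else 1.

Lemma gridvar_val (w : V) : gridvar (val w) = xvar K w.
Proof. by rewrite /gridvar valK. Qed.

Lemma gridvar_neq0 v : gridvar v != 0.
Proof.
rewrite /gridvar; case: insub => [w|]; last exact: oner_neq0.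
exact: mpolyX_neq0.
Qed.

Definition cell_minor e : R :=
  gridvar e * gridvar (e + (1, 1)) - gridvar (e + (0, 1)) * gridvar (e + (1, 0)).

Definition cell_minors s : set R := [set f | exists2 e, e \in s & f = cell_minor e].

(** The saturation of the ideal of cell minors with respect to monomials, that is, the contraction
    of its extension to the Laurent polynomial ring. *)
Definition toric s : set R :=
  [set f | exists m : 'X_{1..n}, ideal_span (cell_minors s) ('X_[m] * f)].

(** The complement consists of the variables at upper right corners of cells of [s], for which the
    cell minors can be solved. *)
Definition free_vars s : {set 'I_n} :=
  finset (fun i => val (enum_val i : V) - (1, 1) \notin s).

Lemma cell_minors_sub s s' : {subset s <= s'} -> cell_minors s `<=` cell_minors s'.
Proof. by move=> ss' f [e es ->]; exists e => //; apply: ss'. Qed.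

Lemma toric_sub s s' : {subset s <= s'} -> toric s `<=` toric s'.
Proof.
move=> ss' f [m fm]; exists m; apply: ideal_span_mono fm; exact: cell_minors_sub.
Qed.

Lemma cell_corners e : e \in P ->
  [/\ e \in V, e + (1, 0) \in V, e + (0, 1) \in V & e + (1, 1) \in V].
Proof.
move=> eP; split; apply: cell_vertices_sub eP _;
  by rewrite !inE ?eqxx ?orbT.
Qed.

Lemma restrict_gridvar s v : v \in V ->
  restrict (free_vars s) (gridvar v) = if v - (1, 1) \in s then 0 else gridvar v.
Proof.
move=> vV; rewrite /gridvar insubT /xvar restrictX inE enum_rankK /=.
by case: (_ \in s).
Qed.

(** Induction on the coordinate sum: the minor of a cell expresses its upper right corner by the
    other three, which have smaller sum and so are already quotients [m' / m] of monomials in the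
    free variables. *)
Lemma gridvar_reduce s : {subset s <= P} -> forall w : V, exists m m' : 'X_{1..n},
  [/\ restrict (free_vars s) 'X_[m] = 'X_[m] :> R,
      restrict (free_vars s) 'X_[m'] = 'X_[m'] :> R &
      ideal_span (cell_minors s) ('X_[m] * gridvar (val w) - 'X_[m'])].
Proof.
move=> sP; set I := ideal_span _; have idI : ideal I by apply: ideal_span_ideal.
apply: (@finite_min_ind _ (fun w : V => (val w).1 + (val w).2)) => w IH.
have [ws|ws] := boolP (val w - (1, 1) \in s); last first.
  exists 0%MM, U_(enum_rank w)%MM; rewrite mpolyX0 rmorph1 mul1r.
  rewrite gridvar_val subrr; split=> //; last by case: idI.
  by rewrite restrictX inE enum_rankK ws.
set e := val w - (1, 1) in ws; have eP := sP e ws.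
have wE : val w = e + (1, 1) by rewrite subrK.
have [eV e1V e2V _] := cell_corners eP.
have below v (vV : v \in V) : v.1 + v.2 < (val w).1 + (val w).2 ->
    exists m m' : 'X_{1..n},
    [/\ restrict (free_vars s) 'X_[m] = 'X_[m] :> R,
      restrict (free_vars s) 'X_[m'] = 'X_[m'] :> R & I ('X_[m] * gridvar v - 'X_[m'])].
  by move=> vw; apply: (IH [` vV]%fset).
have [|m0 [m0' [r0 r0' I0]]] := below _ eV; first by rewrite wE /=; lia.
have [|m1 [m1' [r1 r1' I1]]] := below _ e1V; first by rewrite wE /=; lia.
have [|m2 [m2' [r2 r2' I2]]] := below _ e2V; first by rewrite wE /=; lia.
(* The upper right variable is [x1 * x2 / x0] and each [xi] is ['X_[mi'] / 'X_[mi]]; hence [m0']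
   goes to the denominator and [m0] to the numerator. *)
exists (m0' + m1 + m2)%MM, (m0 + m1' + m2')%MM; rewrite !mpolyXD !rmorphM /=.
rewrite r0 r0' r1 r1' r2 r2' wE; split=> //.
have Ie : I (cell_minor e) by apply: mem_ideal_span; exists e.
have idM a f : I f -> I (a * f) by apply: idealM.
have idD f g : I f -> I g -> I (f + g) by apply: idealD.
set u0 : R := 'X_[m0] in I0 *; set u1 : R := 'X_[m1] in I1 *.
set u2 : R := 'X_[m2] in I2 *.
set w0 : R := 'X_[m0'] in I0 *; set w1 : R := 'X_[m1'] in I1 *.
set w2 : R := 'X_[m2'] in I2 *.
move: Ie I0 I1 I2; rewrite /cell_minor.
move: (gridvar (e + (1, 1))) (gridvar e) (gridvar (e + (1, 0))) (gridvar (e + (0, 1))).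
move=> t x0 x1 x2 Ie I0 I1 I2.
have -> : w0 * u1 * u2 * t - u0 * w1 * w2 = - (u1 * u2 * t) * (u0 * x0 - w0)
  + (u0 * u1 * u2) * (x0 * t - x2 * x1)
  + (u0 * u1 * x1) * (u2 * x2 - w2) + (u0 * w2) * (u1 * x1 - w1) by ring.
by apply: (idD); [apply: (idD); [apply: (idD) |] |]; apply: idM.
Qed.

Lemma toric_reduce s : {subset s <= P} -> forall f : R, exists (m : 'X_{1..n}) (g : R),
  [/\ restrict (free_vars s) 'X_[m] = 'X_[m] :> R, restrict (free_vars s) g = g &
      ideal_span (cell_minors s) ('X_[m] * f - g)].
Proof.
move=> sP; set I := ideal_span _; have idI : ideal I by apply: ideal_span_ideal.
pose red f := exists (m : 'X_{1..n}) (g : R),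
  [/\ restrict (free_vars s) 'X_[m] = 'X_[m] :> R, restrict (free_vars s) g = g &
      I ('X_[m] * f - g)].
have redC c : red c%:MP.
  exists 0%MM, c%:MP; rewrite restrictC mpolyX0 rmorph1 mul1r subrr.
  by split=> //; case: idI.
have redM f f' : red f -> red f' -> red (f * f').
  move=> [m [g [rm rg fg]]] [m' [g' [rm' rg' fg']]]; exists (m + m')%MM, (g * g').
  rewrite mpolyXD !rmorphM /= rm rm' rg rg'; split=> //.
  have -> : 'X_[m] * 'X_[m'] * (f * f') - g * g' =
     ('X_[m'] * f') * ('X_[m] * f - g) + g * ('X_[m'] * f' - g') by ring.
  by apply: idealD => //; apply: idealM.
have redD f f' : red f -> red f' -> red (f + f').
  move=> [m [g [rm rg fg]]] [m' [g' [rm' rg' fg']]].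
  exists (m + m')%MM, ('X_[m'] * g + 'X_[m] * g').
  rewrite mpolyXD rmorphD !rmorphM /= rm rm' rg rg'; split=> //.
  have -> : 'X_[m] * 'X_[m'] * (f + f') - ('X_[m'] * g + 'X_[m] * g') =
     'X_[m'] * ('X_[m] * f - g) + 'X_[m] * ('X_[m'] * f' - g') by ring.
  by apply: idealD => //; apply: idealM.
have redX i : red 'X_i.
  have [m [m' [rm rm' Im]]] := gridvar_reduce sP (enum_val i).
  rewrite gridvar_val /xvar enum_valK in Im.
  by exists m, 'X_[m'].
elim/mpolyind => [|c m f _ _ IH]; first by rewrite -mpolyC0; apply: redC.
apply: (redD) => //; rewrite -mul_mpolyC; apply: (redM) => //.
rewrite mpolyXE_id; apply: (big_ind red) => [|f1 f2|i _].
- by rewrite -mpolyC1.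
- exact: redM.
- by elim: (m i) => [|k IHk]; rewrite ?expr0 -?mpolyC1 // exprS; apply: redM.
Qed.

Section Embedding.
Variables (F : fieldType) (iota : {rmorphism R -> F}).
Hypothesis iota_inj : injective iota.
Implicit Types (th : gridpoint -> F).

Definition torus_eval th : {rmorphism R -> F} :=
  mmap (iota \o @mpolyC n K) (fun i => th (val (enum_val i : V))).

Lemma torus_eval_gridvar th v : v \in V -> torus_eval th (gridvar v) = th v.
Proof.
move=> vV; rewrite /gridvar insubT /xvar /torus_eval /= mmapX mmap1U.
by rewrite enum_rankK.
Qed.

Lemma torus_eval_monomial th (m : 'X_{1..n}) :
  (forall v, th v != 0) -> torus_eval th 'X_[m] != 0.
Proof.
move=> th0; rewrite /torus_eval /= mmapX; apply/prodf_neq0 => i _.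
exact: expf_neq0.
Qed.

Lemma torus_eval_cell_minor th e : e \in P ->
  cell_relation th e -> torus_eval th (cell_minor e) = 0.
Proof.
move=> eP the; have [? ? ? ?] := cell_corners eP.
by rewrite rmorphB !rmorphM /= !torus_eval_gridvar // the subrr.
Qed.

(** [th] is a generic point: its free coordinates are the variables themselves in [F], the others
    are solved from the cell relations. An [f] vanishing there reduces, up to a monomial, to some
    [g] in the free variables, and [iota g = 0] forces [g = 0]. *)
Lemma toric_kernel s : {subset s <= P} -> exists th,
  [/\ forall v, th v != 0, forall e, e \in s -> cell_relation th e,
      forall f, torus_eval th (restrict (free_vars s) f) =
                iota (restrict (free_vars s) f) &
      toric s = [set f | torus_eval th f = 0]].
Proof.
move=> sP; have [v|th [th0 ths thx]] := @cell_relations_solvable F (iota \o gridvar) s.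
  by rewrite /= -(rmorph0 iota) (inj_eq iota_inj) gridvar_neq0.
exists th; have thE f : torus_eval th (restrict (free_vars s) f) =
                iota (restrict (free_vars s) f).
  move: f; apply: (@mpoly_rmorph_eq _ _ _ (torus_eval th \o restrict (free_vars s))
    (iota \o restrict (free_vars s))) => [c|i] /=.
    by rewrite restrictC /torus_eval /= mmapC.
  rewrite restrictX; case: ifP => iA; last by rewrite !rmorph0.
  rewrite /torus_eval /= mmapX mmap1U; move: iA; rewrite inE => /thx -> /=.
  by rewrite gridvar_val /xvar enum_valK.
have kills : ideal_span (cell_minors s) `<=` [set f | torus_eval th f = 0].
  apply: ideal_spanP; first exact/prime_ideal_ideal/kernel_prime.
  by move=> _ [e es ->]; apply: torus_eval_cell_minor; [apply: sP | apply: ths].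
split=> //; apply/seteqP; split=> f /=.
  move=> [m /kills /eqP]; rewrite rmorphM mulf_eq0.
  by rewrite (negPf (torus_eval_monomial _ th0)) => /eqP.
have [m [g [rm rg fg]]] := toric_reduce sP f => thf.
suff g0 : g = 0 by exists m; rewrite g0 subr0 in fg.
have /= := kills _ fg.
rewrite rmorphB rmorphM /= thf mulr0 sub0r -rg thE => /eqP.
by rewrite oppr_eq0 -(rmorph0 iota) (inj_eq iota_inj) => /eqP.
Qed.

End Embedding.

Lemma toric_prime s : {subset s <= P} -> prime_ideal (toric s).
Proof.
have [F [iota inj]] := fraction_embedding R.
by move=> /(toric_kernel inj)[th [_ _ _ ->]]; apply: kernel_prime.
Qed.

Lemma toric_monomial s (m : 'X_{1..n}) : {subset s <= P} -> ~ toric s 'X_[m].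
Proof.
have [F [iota inj]] := fraction_embedding R.
by move=> /(toric_kernel inj)[th [th0 _ _ ->]] /=; apply/eqP/torus_eval_monomial.
Qed.

Lemma toric_independent s : {subset s <= P} ->
  independent_mod (toric s) (free_vars s).
Proof.
have [F [iota inj]] := fraction_embedding R.
move=> /(toric_kernel inj)[th [_ _ thE ->]] f /=; rewrite thE -(rmorph0 iota).
exact: inj.
Qed.

Lemma toric_proper s s' e : {subset s <= s'} -> {subset s' <= P} ->
  e \in s' -> e \notin s -> toric s `<` toric s'.
Proof.
move=> ss' s'P es' es; split; first exact: toric_sub.
have sP v : v \in s -> v \in P by move=> /ss'/s'P.
have [_ _ _ tV] := cell_corners (s'P _ es').
have [m [m' [rm rm' Im]]] := gridvar_reduce s'P [` tV]%fset; rewrite /= in Im.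
have free_sub : free_vars s' \subset free_vars s.
  by apply/fintype.subsetP => i; rewrite !inE; apply: contra; apply: ss'.
have res (f : R) : restrict (free_vars s') f = f -> restrict (free_vars s) f = f.
  by move=> <-; rewrite restrict_restrict.
(* The class of the corner [e + (1, 1)] becomes algebraic when [e] is added. *)
set f := _ - _ in Im; move=> s's.
have f0 : f = 0.
  have rf : restrict (free_vars s) f = f.
    rewrite rmorphB rmorphM /= restrict_gridvar // addrK (negPf es).
    by rewrite (res _ rm) (res _ rm').
  rewrite -rf; apply: toric_independent => //; rewrite rf; apply: s's.
  by exists 0%MM; rewrite mpolyX0 mul1r.
(* Setting the variables that are not free for [s'] to zero, among them the one at [e + (1, 1)],
   leaves [- 'X_[m']], which is nonzero. *)
have := congr1 (restrict (free_vars s')) f0.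
rewrite rmorphB rmorphM /= restrict_gridvar // addrK es' mulr0 rm' sub0r rmorph0.
by move/eqP; rewrite oppr_eq0; apply/negP/mpolyX_neq0.
Qed.

(** Translation by [(-1, -1)] maps the vertices that are not free injectively into [P]. *)
Lemma card_free_vars : (n <= #|free_vars P| + #|` P|)%N.
Proof.
have := cardsC (free_vars P); rewrite card_ord.
suff : (#|~: free_vars P|%SET <= #|` P|)%N by lia.
rewrite cardE.
pose f (i : 'I_n) := val (enum_val i : V) - (1, 1).
rewrite -(size_map f); apply: uniq_leq_size.
  rewrite map_inj_uniq ?enum_uniq // => i j /addIr /val_inj; exact: enum_val_inj.
by move=> _ /mapP[i + ->]; rewrite mem_enum !inE negbK.
Qed.

Lemma toric_height : prime_height (toric P) #|` P|.
Proof.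
split; last first.
  move=> k /prime_chain_leq; have PP : {subset enum_fset P <= P} by [].
  have := indep_dim_ge (toric_independent PP); have := card_free_vars; lia.
have sP k : {subset take k P <= P} by move=> e; apply: mem_take.
(* Adding the cells one by one, from [toric [::]] on, gives one strict inclusion per cell. *)
exists (fun k => toric (take k P)); split=> [i _|i iP|].
- exact: toric_prime.
- apply: (@toric_proper _ _ (nth 0 P i)) => //.
  + by move=> e; rewrite (take_nth 0) // mem_rcons inE orbC => ->.
  + by rewrite (take_nth 0) // mem_rcons mem_head.
  + by rewrite in_take_leq ?index_uniq ?fset_uniq ?ltnn // ltnW.
- by rewrite take_size.
Qed.

Lemma cell_minors_inner : cell_minors P `<=` inner_minors K P.
Proof.
move=> _ [e eP ->]; have [eV e1V e2V e12V] := cell_corners eP.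
exists [` eV]%fset, [` e12V]%fset, [` e2V]%fset, [` e1V]%fset => /=.
split.
- split=> [|e']; first by rewrite /proper_interval /=; lia.
  rewrite /cell_of_interval /le_gridpoint /= => ee'.
  have -> // : e' = e.
  case: e e' ee' {eP eV e1V e2V e12V} => [x y] [x' y'] /= ee'.
  by congr (_, _); lia.
- by rewrite /=; case: (e) => x y; congr (_, _) => /=; lia.
- by rewrite /=; case: (e) => x y; congr (_, _) => /=; lia.
- by rewrite /cell_minor -!gridvar_val.
Qed.

Lemma inner_minors_toric : inner_minors K P `<=` toric P.
Proof.
have [F [iota inj]] := fraction_embedding R.
have [th [th0 thP _ ->]] := toric_kernel inj (fun e (eP : e \in enum_fset P) => eP).
move=> _ [a [b [c [d [inP cE dE ->]]]]] /=.
rewrite rmorphB !rmorphM /= -!gridvar_val !torus_eval_gridvar ?fsvalP //.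
by rewrite (inner_interval_relation th0 thP inP) cE dE subrr.
Qed.

Lemma cell_ideal_toric : cell_ideal K P `<=` toric P.
Proof.
apply: ideal_spanP inner_minors_toric.
exact/prime_ideal_ideal/toric_prime.
Qed.

Lemma toric_associated : associated_prime (cell_ideal K P) (toric P).
Proof.
have pT : prime_ideal (toric P) by apply: toric_prime.
have idI : ideal (cell_ideal K P) by apply: ideal_span_ideal.
split=> //; have [r [rT Tr]] := hilbert_basis (prime_ideal_ideal pT).
(* Some monomial carries each generator of the toric ideal into the cell ideal; the product ['X_[m]]
   of these serves all generators. *)
have [m mr] : exists m : 'X_{1..n}, forall u, u \in r -> cell_ideal K P (u * 'X_[m]).
  elim: r rT {Tr} => [|u r IH] rT; first by exists 0%MM.
  have [|m mr] := IH; first by move=> v vr; apply: rT; rewrite inE vr orbT.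
  have [m' um'] := rT u (mem_head _ _); exists (m + m')%MM => v.
  rewrite mpolyXD; case/predU1P => [->|/mr vm].
    rewrite mulrCA [u * _]mulrC; apply: idealM => //.
    exact: ideal_span_mono cell_minors_inner _ um'.
  by rewrite mulrA mulrC; apply: idealM.
exists 'X_[m]; apply/seteqP; split=> f /=; last first.
  (* The toric prime contains no monomial, so [f * 'X_[m]] in it forces [f] in it. *)
  move=> /cell_ideal_toric /(prime_idealM pT)[//|]; by move/toric_monomial; case.
have idC : ideal [set u | cell_ideal K P (u * 'X_[m])].
  split=> [|a v w Iv Iw] /=; first by rewrite mul0r; case: idI.
  by rewrite mulrDl -mulrA; have [_] := idI; apply.
by move=> /Tr /(ideal_spanP idC); apply.
Qed.

End Toric.

(** * Existence of heights, and the inequalities *)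

Section Heights.
Variable R : comNzRingType.
Implicit Types (I p q : set R).

Lemma prime_chain0 p : prime_ideal p -> prime_chain p 0.
Proof. by move=> pp; exists (fun=> p). Qed.

(** The top of the chain is replaced by [q], and the primes below it are kept. *)
Lemma prime_chain_above p q k :
  p `<=` q -> prime_ideal q -> prime_chain p k -> prime_chain q k.
Proof.
move=> pq qq [c [cP c_lt ck]]; exists (fun i => if (i < k)%N then c i else q).
split=> [i ik|i ik|]; last by rewrite ltnn.
  by case: ifP => // ik'; apply: cP.
rewrite ik; case: ltnP => [_|ki]; first exact: c_lt.
have iE : i.+1 = k by apply/eqP; rewrite eqn_leq ik.
have cq : c i.+1 `<=` q by rewrite iE ck.
have [cc ncc] := c_lt i ik; split; first exact: subset_trans cq.
by move=> qc; apply: ncc; apply: subset_trans qc.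
Qed.

Lemma prime_height_exists p N : prime_ideal p ->
  (forall k, prime_chain p k -> (k <= N)%N) ->
  exists k, prime_height p k /\ (k <= N)%N.
Proof.
move=> pp leN.
have ex : exists k, `[< prime_chain p k >] by exists 0%N; apply/asboolP/prime_chain0.
have ub k : `[< prime_chain p k >] -> (k <= N)%N by move/asboolP/leN.
case: (ex_maxnP ex ub) => k /asboolP pk maxk; exists k; split; last exact: leN.
by split=> // j /asboolP/maxk.
Qed.

Lemma ideal_height_exists I p k : prime_ideal p -> I `<=` p -> prime_height p k ->
  exists2 h, ideal_height I h & (h <= k)%N.
Proof.
move=> pp Ip pk.
have ex : exists h, `[< exists p, [/\ prime_ideal p, I `<=` p & prime_height p h] >].
  by exists k; apply/asboolP; exists p.
case: (ex_minnP ex) => h /asboolP hP minh; exists h.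
  by split=> // q j qq Iq qj; apply: minh; apply/asboolP; exists q.
by apply: minh; apply/asboolP; exists p.
Qed.

Lemma bigheight_exists I p k N :
  (forall q j, prime_chain q j -> (j <= N)%N) ->
  associated_prime I p -> prime_height p k ->
  exists2 b, bigheight I b & (k <= b)%N.
Proof.
move=> leN pI pk.
have ex : exists b, `[< exists q, associated_prime I q /\ prime_height q b >].
  by exists k; apply/asboolP; exists p.
have ub b : `[< exists q, associated_prime I q /\ prime_height q b >] -> (b <= N)%N.
  by move/asboolP => [q [_ [/leN]]].
case: (ex_maxnP ex ub) => b /asboolP bP maxb; exists b.
  split=> // q qI; have [j [qj _]] := prime_height_exists qI.1 (leN q).
  by exists j => //; apply: maxb; apply/asboolP; exists q.
by apply: maxb; apply/asboolP; exists p.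
Qed.

End Heights.

Theorem theorem1p1 (K : fieldType) (P : {fset gridpoint}) :
  exists h b : nat,
    [/\ ideal_height (cell_ideal K P) h,
        bigheight (cell_ideal K P) b,
        (h <= #|` P| <= b)%N &
        unmixed (cell_ideal K P) -> h = #|` P|].
Proof.
have assT := toric_associated K P; have htT := toric_height K P.
have [h hI hc] := ideal_height_exists assT.1 (@cell_ideal_toric K P) htT.
have [|b bI cb] := @bigheight_exists _ _ _ _ #|{: vertices P}| _ assT htT.
  by move=> q j /prime_chain_leq; apply: leq_trans; apply: leq_addr.
exists h, b; split=> //; first by rewrite hc.
move=> unm; apply/eqP; rewrite eqn_leq hc /=.
(* [p] attains the height and contains an associated prime [q], whose height is the number of cells
   by unmixedness; a chain of that length ending in [q] yields one ending in [p]. *)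
have [[p [pp Ip [_ maxp]]] _] := hI.
have [q [assq _ qp]] := associated_prime_below (ideal_span_ideal _) pp Ip.
by apply/maxp/(prime_chain_above qp pp); case: ((unm _ _ assT assq _).1 htT).
Qed.
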